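(* Let $A$ be a subset of a Banach space $X$. Then there exists a countable subset $A_0\subset A$ such that $A$ is strongly finitely representable in $A_0$.
   Context: A convex polyhedron in a Banach space is the convex hull $H$ of finitely many points; its vertex set $\mathrm{vert}(H)$ is its (finite) set of extreme points. For non-negative integers $n,m$, an $(n,m)$-polyhedron is a convex polyhedron $H$ whose affine hull $\mathrm{aff}(H)$ has dimension $n$ and which has exactly $n+m+1$ vertices. For a Banach space $Y$ with closed unit ball $B_Y$, the Hausdorff distance of nonempty bounded sets $C,D\subset Y$ is $d_{\mathfrak H}(C,D)=\inf\{r>0: C\subset D+rB_Y,\ D\subset C+rB_Y\}$. Let $X,Y$ be Banach spaces, $A\subset X$, $B\subset Y$. Given $\varepsilon>0$, $A$ is $\varepsilon$-strongly finitely representable in $B$ if for every pair $n,m$ of non-negative integers and every $(n,m)$-polyhedron $H\subset X$ with $\mathrm{vert}(H)\subset A$, there exist an $(n,m)$-polyhedron $H'\subset Y$ with $\mathrm{vert}(H')\subset B$ and an affine isomorphism $T:\mathrm{aff}(H)\to\mathrm{aff}(H')$ such that $(1-\varepsilon)\|x-y\|\le\|Tx-Ty\|\le(1+\varepsilon)\|x-y\|$ for all $x,y\in\mathrm{aff}(H)$ and $d_{\mathfrak H}(\mathrm{vert}(T(H)),\mathrm{vert}(H'))<\varepsilon$. $A$ is strongly finitely representable in $B$ if it is $\varepsilon$-strongly finitely representable in $B$ for all $\varepsilon>0$. *)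

(* Defs.v *)
From HB Require Import structures.
From mathcomp Require Import all_boot all_order all_algebra.
From mathcomp Require Import all_classical all_reals all_analysis.

Set Implicit Arguments.
Unset Strict Implicit.
Unset Printing Implicit Defensive.

Import Order.TTheory GRing.Theory Num.Theory.
Import numFieldNormedType.Exports.

Local Open Scope classical_set_scope.
Local Open Scope ring_scope.

Section Polyhedra.
Context {R : realType} {X : normedModType R}.
Implicit Types (S H L : set X).

Definition conv_hull S : set X := smallest (@convex_set R X) S.

Definition affine_set L : Prop :=
  forall (x y : X) (t : R), L x -> L y -> L (t *: x + (1 - t) *: y).

Definition aff S : set X := smallest affine_set S.

(* [L] is a translate of a linear subspace having a basis of [n] vectors. *)
Definition has_affine_dim (n : nat) L : Prop :=
  exists (x0 : X) (b : 'I_n -> X),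
    (forall a : 'I_n -> R, \sum_(i < n) a i *: b i = 0 -> forall i, a i = 0) /\
    L = [set x0 + \sum_(i < n) a i *: b i | a in [set: 'I_n -> R]].

Definition convex_polyhedron H : Prop :=
  exists s : seq X, H = conv_hull [set` s].

Definition vert H : set X :=
  [set x | H x /\ forall (y z : X) (t : R), H y -> H z -> 0 < t < 1 ->
             x = t *: y + (1 - t) *: z -> y = x /\ z = x].

Definition nm_polyhedron (n m : nat) H : Prop :=
  [/\ convex_polyhedron H, has_affine_dim n (aff H)
    & (vert H #= `I_(n + m + 1))%card].

(* Valued in the extended reals so that an empty set of radii gives [+oo];
   on nonempty bounded sets the value is finite. *)
Definition hausdorff_dist (C D : set X) : \bar R :=
  ereal_inf [set r%:E | r in [set r : R | [/\ 0 < r,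
    C `<=` [set d + r *: u | d in D & u in closed_ball (0 : X) 1] &
    D `<=` [set c + r *: u | c in C & u in closed_ball (0 : X) 1]]]].

End Polyhedra.

Section Representability.
Context {R : realType} {X Y : completeNormedModType R}.

(* Only the restriction of [T] to [L] matters. *)
Definition affine_iso (L : set X) (L' : set Y) (T : X -> Y) : Prop :=
  set_bij L L' T /\
  forall (x y : X) (t : R), L x -> L y ->
    T (t *: x + (1 - t) *: y) = t *: T x + (1 - t) *: T y.

Definition eps_strongly_finitely_representable
    (eps : R) (A : set X) (B : set Y) : Prop :=
  forall (n m : nat) (H : set X), nm_polyhedron n m H -> vert H `<=` A ->
  exists (H' : set Y) (T : X -> Y),
    [/\ nm_polyhedron n m H',
        vert H' `<=` B,
        affine_iso (aff H) (aff H') T,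
        (forall x y : X, aff H x -> aff H y ->
           (1 - eps) * `|x - y| <= `|T x - T y| <= (1 + eps) * `|x - y|)
      & (hausdorff_dist (vert (T @` H)) (vert H') < eps%:E)%E].

Definition strongly_finitely_representable (A : set X) (B : set Y) : Prop :=
  forall eps : R, 0 < eps -> eps_strongly_finitely_representable eps A B.

End Representability.

(* Main.v *)
Require Import Defs.
From mathcomp Require Import all_boot all_order all_algebra.
From mathcomp Require Import all_classical all_reals all_analysis.
From mathcomp Require Import lra.

Set Implicit Arguments.
Unset Strict Implicit.
Unset Printing Implicit Defensive.

Import Order.TTheory GRing.Theory Num.Theory.
Import numFieldNormedType.Exports.

Local Open Scope classical_set_scope.
Local Open Scope ring_scope.

(** Almost isometry of polyhedra is decided by a separable invariant.

Attach to an (n,m)-polyhedron H the finite family w made of an origin and a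
basis of aff H together with the vertices of H, and to w the seminorm
a |-> |sum_i a_i w_i| on the coefficient vectors. If two polyhedra H and H'
have families whose seminorms differ by at most d times the l1 norm, then the
affine map T sending origin to origin and basis to basis does all that is
wanted when d is small enough, depending on H. It is a bijection of the affine hulls, whatever d is. On the direction
space of aff H, where all norms are equivalent (sum_norm_le_lincomb), the
additive error d becomes a relative error. Finally, the relation expressing a
vertex of H in the basis of H says that a certain combination of w vanishes, so
the same combination of w' is small, and this says that T maps this vertex
close to the corresponding vertex of H' (close_frames_map).

The space of such seminorms is separable: up to any given error, a seminorm is
determined, among all others, by the integer parts of its values on a finite grid of integer
vectors. So countably many polyhedra with vertices in A approximate all the
others (countable_norm_dense), and A0 consists of their vertices.

The origin and the basis need not lie in A. This is harmless because only the
vertices of the selected polyhedra enter A0, and it makes it unnecessary to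
extract an affine basis from the vertices or to compare the dimensions of the
affine hulls. *)

(** * Separability of the seminorms of finite families *)

(** Choose one element of [P] in each nonempty fibre of [f]. *)
Lemma countable_section (T : Type) (C : countType) (P : set T) (f : T -> C) :
  exists S : set T,
    [/\ S `<=` P, countable S & forall x, P x -> exists2 y, S y & f y = f x].
Proof.
have [->|/set0P[x0 Px0]] := eqVneq P set0.
  by exists set0; split=> //; exact: countable0.
have [g gP'] :
    {g & forall c, P (g c) /\ forall x, P x -> f x = c -> f (g c) = c}.
  apply: (@choice _ _ (fun c y => P y /\ forall x, P x -> f x = c -> f y = c)).
  move=> c; have [[x Px fx]|nx] := pselect (exists2 x, P x & f x = c).
    by exists x.
  by exists x0; split=> // x Px fx; case: nx; exists x.
have gP x : P x -> P (g (f x)) /\ f (g (f x)) = f x.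
  by move=> Px; have [? /(_ x Px erefl)] := gP' (f x).
exists (g @` (f @` P)); split.
- by move=> _ [_ [x Px <-] <-]; exact: (gP x Px).1.
- by apply: sub_countable (card_image_le _ _) _; exact: countableP.
- move=> x Px; exists (g (f x)); last exact: (gP x Px).2.
  by exists (f x) => //; exists x.
Qed.

Section LinearCombinations.
Context {R : realType} {X : normedModType R} {I : finType}.
Implicit Types (w : I -> X) (a : I -> R).

Definition lincomb w a : X := \sum_i a i *: w i.

Lemma lincombB w a a' :
  lincomb w (fun i => a i - a' i) = lincomb w a - lincomb w a'.
Proof.
by rewrite -sumrB; apply: eq_bigr => i _; rewrite scalerBl.
Qed.

Lemma lincombD w a a' :
  lincomb w (fun i => a i + a' i) = lincomb w a + lincomb w a'.
Proof.
by rewrite -big_split; apply: eq_bigr => i _; rewrite scalerDl.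
Qed.

Lemma lincombZ w c a : lincomb w (fun i => c * a i) = c *: lincomb w a.
Proof. by rewrite scaler_sumr; apply: eq_bigr => i _; rewrite scalerA. Qed.

Lemma lincomb_delta w c j :
  lincomb w (fun i => if i == j then c else 0) = c *: w j.
Proof.
rewrite /lincomb (bigD1 j)//= eqxx big1 ?addr0// => i /negPf ->.
by rewrite scale0r.
Qed.

Lemma norm_lincomb_le w a (c : R) : (forall i, `|a i| <= c) ->
  `|lincomb w a| <= c * \sum_i `|w i|.
Proof.
move=> ac; rewrite mulr_sumr (le_trans (ler_norm_sum _ _ _))// ler_sum// => i _.
by rewrite normrZ ler_wpM2r.
Qed.

(** The grid {-K, ..., K}^I is encoded by shifting, as functions into
'I_(2 * K).+1, so that the codes form a countable type. Grid points are not
divided by K: with integer vectors, integer parts are precise enough, since the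
unit error is divided by K when one goes back to coefficients in [-1, 1]. *)
Definition norm_code (K : nat) w : {ffun {ffun I -> 'I_(2 * K).+1} -> nat} :=
  [ffun z : {ffun I -> 'I_(2 * K).+1} =>
    Num.truncn `|lincomb w (fun i => (z i)%:R - K%:R)|].

Lemma norm_code_close K w w' (z : {ffun I -> 'I_(2 * K).+1}) :
  norm_code K w' = norm_code K w ->
  `| `|lincomb w (fun i => (z i)%:R - K%:R)| -
     `|lincomb w' (fun i => (z i)%:R - K%:R)| | <= 1.
Proof.
move=> /ffunP/(_ z); rewrite !ffunE.
set p := `|lincomb w _|; set q := `|lincomb w' _| => pq.
have /andP[p1 p2] := truncn_itv (normr_ge0 _ : 0 <= p).
have /andP[] := truncn_itv (normr_ge0 _ : 0 <= q).
rewrite pq => q1 q2; rewrite ler_norml; move: p2 q2; rewrite -natr1.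
set t := (Num.truncn p)%:R in p1 q1 *.
by move=> p2 q2; apply/andP; split; lra.
Qed.

(** Testing the code on K times a unit vector of R^I makes the error bound below
depend on [w] alone, and not on the family [w'] selected later. *)
Lemma norm_code_le K w w' j : norm_code K w' = norm_code K w -> (0 < K)%N ->
  `|w' j| <= `|w j| + 1.
Proof.
move=> ww' K0.
have K2 : (2 * K < (2 * K).+1)%N by [].
have K1 : (K < (2 * K).+1)%N by rewrite ltnS mul2n -addnn leq_addr.
have := @norm_code_close K w w'
  [ffun i => if i == j then Ordinal K2 else Ordinal K1] ww'.
have E (u : I -> X) : lincomb u (fun i => ([ffun i => if i == j then Ordinal K2
    else Ordinal K1] i : nat)%:R - K%:R) = K%:R *: u j.
  rewrite -lincomb_delta; apply: eq_bigr => i _; rewrite ffunE.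
  by case: eqP => _ /=; rewrite ?subrr// mul2n -addnn natrD addrK.
rewrite !E !normrZ normr_nat -mulrBr normrM normr_nat => H.
have K1' : (1 : R) <= K%:R by rewrite ler1n.
have : `| `|w j| - `|w' j| | <= 1.
  by rewrite (le_trans _ H)// ler_peMl.
by rewrite ler_norml => /andP[]; lra.
Qed.

(** Round K * a to the grid: both seminorms then move by at most the sum of the
norms of the vectors, and on the grid they differ by at most 1. The right-hand
side does not depend on K, so the difference at [a] is O(1/K). *)
Lemma norm_code_lipschitz K w w' a :
  norm_code K w' = norm_code K w -> (0 < K)%N -> (forall i, `|a i| <= 1) ->
  K%:R * `| `|lincomb w a| - `|lincomb w' a| | <=
    1 + (\sum_i `|w i| + \sum_i (`|w i| + 1)).
Proof.
move=> ww' K0 a1.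
(* K * (a i + 1) lies in [0, 2K]; the grid point is its integer part. *)
pose z := [ffun i => inord (Num.truncn (K%:R * (a i + 1))) : 'I_(2 * K).+1].
have az i : `|K%:R * a i - ((z i)%:R - K%:R)| <= 1.
  have K0' : (0 : R) <= K%:R by [].
  have := a1 i; rewrite ler_norml => /andP[a1l a1r].
  have pos : 0 <= K%:R * (a i + 1) by rewrite mulr_ge0//; lra.
  have /andP[z1 z2] := truncn_itv pos.
  rewrite ffunE inordK; last first.
    rewrite ltnS truncn_le_nat (@le_lt_trans _ _ (2 * K)%:R) ?ltr_nat//.
    by rewrite natrM mulrC ler_wpM2r//; lra.
  move: z1 z2; rewrite -natr1 mulrDr mulr1.
  set t := (Num.truncn _)%:R; set u := K%:R * a i.
  by move=> z1 z2; rewrite ler_norml; apply/andP; split; lra.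
have near (u : I -> X) : `| `|lincomb u (fun i => K%:R * a i)| -
    `|lincomb u (fun i => (z i)%:R - K%:R)| | <= \sum_i `|u i|.
  rewrite (le_trans (ler_dist_dist _ _))// -lincombB.
  by rewrite -[leRHS]mul1r; exact: norm_lincomb_le.
have w'le : \sum_i `|w' i| <= \sum_i (`|w i| + 1).
  by apply: ler_sum => i _; exact: norm_code_le ww' K0.
have := near w; have := near w'; have := norm_code_close z ww'.
have scale x : K%:R * `|x| = `|K%:R * x : R| by rewrite normrM normr_nat.
rewrite !lincombZ !normrZ normr_nat scale mulrBr.
set p := K%:R * _; set q := K%:R * _.
rewrite !ler_norml => /andP[? ?] /andP[? ?] /andP[? ?].
by apply/andP; split; lra.
Qed.

(** For each K pick one representative of each code. Given [w] and [d], a large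
enough K makes the bound of norm_code_lipschitz at most [d] on coefficients of
l1 norm 1, and homogeneity gives the rest. *)
Lemma countable_norm_dense (P : set (I -> X)) :
  exists S : set (I -> X), [/\ S `<=` P, countable S &
    forall w (d : R), P w -> 0 < d -> exists2 w', S w' &
      forall a, `| `|lincomb w a| - `|lincomb w' a| | <= d * \sum_i `|a i|].
Proof.
have [S SP] := choice (fun K => countable_section P (norm_code K)).
exists (\bigcup_K S K); split.
- by apply: bigcup_sub => K _; have [] := SP K.
- by apply: bigcup_countable => // K _; have [] := SP K.
move=> w d Pw d0.
pose C := 1 + (\sum_i `|w i| + \sum_i (`|w i| + 1)).
pose K := (Num.truncn (C / d)).+1.
have CK : C <= K%:R * d by rewrite -ler_pdivrMr// ltW// truncnS_gt.
have [_ _ /(_ w Pw)[w' Sw' ww']] := SP K; exists w'; first by exists K.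
move=> a; set s := \sum_i _.
have : 0 <= s by rewrite sumr_ge0.
rewrite le_eqVlt => /predU1P[s0|s0].
  have a0 i : a i = 0.
    apply/eqP; rewrite -normr_eq0; move/esym/eqP: s0.
    by rewrite psumr_eq0// => /allP/(_ i); rewrite mem_index_enum; exact.
  rewrite -s0 mulr0 /lincomb !big1 ?subrr ?normr0// => i _;
    by rewrite a0 scale0r.
pose a' i := s^-1 * a i.
have a'1 i : `|a' i| <= 1.
  rewrite normrM gtr0_norm ?invr_gt0// mulrC ler_pdivrMr// mul1r.
  by rewrite /s (bigD1 i)//= lerDl sumr_ge0.
have aE (u : I -> X) : `|lincomb u a| = s * `|lincomb u a'|.
  by rewrite lincombZ normrZ gtr0_norm ?invr_gt0// mulVKf// gt_eqF.
rewrite !aE -mulrBr normrM gtr0_norm// mulrC ler_pM2r//.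
have K0 : (0 : R) < K%:R by rewrite ltr0n.
rewrite -(ler_pM2l K0) (le_trans _ CK)//.
exact: norm_code_lipschitz.
Qed.

End LinearCombinations.
(** * Linear and affine independence *)

Section Independence.
Context {R : realType} {X : normedModType R} {n : nat}.
Implicit Types (b : 'I_n -> X) (a : 'I_n -> R).

Definition lin_indep b := forall a, lincomb b a = 0 -> forall i, a i = 0.

Lemma lincomb_inj b a a' : lin_indep b -> lincomb b a = lincomb b a' ->
  forall i, a i = a' i.
Proof.
move=> bi aa' i; apply/eqP; rewrite -subr_eq0; apply/eqP.
by apply: (bi (fun i => a i - a' i)); rewrite lincombB aa' subrr.
Qed.

(** Equivalence of norms in finite dimension: on the compact l1 unit sphere the
continuous function |lincomb b a| attains its minimum, which is positive by
independence. *)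
Lemma sum_norm_le_lincomb b : lin_indep b ->
  exists2 C : R, 0 < C & forall a, \sum_i `|a i| <= C * `|lincomb b a|.
Proof.
move=> bi.
pose one := fun v : 'rV[R]_n => \sum_i `|v ord0 i|.
have coordc i : continuous (fun v : 'rV[R]_n => v ord0 i).
  exact: coord_continuous.
have onec : continuous one.
  move=> v; apply: (@cvg_big _ _ _ _ _ add_continuous _ (nbhs v)) => i _.
  by apply: (continuous_comp (coordc i v)); exact: norm_continuous.
have fc : continuous (fun v : 'rV[R]_n => `|lincomb b (v ord0)|).
  move=> v; apply: (@continuous_comp _ _ _
    (fun v : 'rV[R]_n => lincomb b (v ord0)) (fun x => `|x|)); last first.
    exact: norm_continuous.
  apply: (@cvg_big _ _ _ _ _ add_continuous _ (nbhs v)) => i _.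
  by apply: cvgZr_tmp; exact: coordc.
pose S := [set v | one v = 1].
have Sc : compact S.
  apply: bounded_closed_compact.
    exists 1; split=> // M M1 v Sv.
    rewrite /= [leLHS]/Num.norm /= mx_normrE; apply/bigmax_leP.
    split; first lra.
    move=> [i j] _ /=; rewrite ord1 (le_trans _ (ltW M1))//.
    by rewrite -Sv /one (bigD1 j)//= lerDl sumr_ge0.
  rewrite (_ : S = one @^-1` [set 1])//; apply: preimage_closed.
    by move=> v _; exact: onec.
  exact: closed_eq.
have scaleS (a : 'I_n -> R) : 0 < \sum_i `|a i| ->
    S (\row_i ((\sum_i `|a i|)^-1 * a i)).
  move=> a0; rewrite /S/= /one.
  transitivity (\sum_i (\sum_i `|a i|)^-1 * `|a i|).
    by apply: eq_bigr => i _; rewrite mxE normrM gtr0_norm ?invr_gt0.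
  by rewrite -mulr_sumr mulVf// gt_eqF.
(* The sphere is empty exactly when n = 0; the minimum then makes no sense. *)
have [S0|/set0P Sn0] := eqVneq S set0.
  exists 1 => // a; rewrite mul1r.
  have [->//|a0] := eqVneq (\sum_i `|a i|) 0.
  have a0' : 0 < \sum_i `|a i| by rewrite lt_neqAle eq_sym a0 sumr_ge0.
  by have := scaleS a a0'; rewrite S0.
have [c cS cmin] := EVT_min_rV Sn0 Sc (continuous_subspaceT fc).
rewrite inE in cS.
have c0 : 0 < `|lincomb b (c ord0)|.
  rewrite normr_gt0; apply/eqP => /bi c0.
  have := cS; rewrite /S/= /one big1.
    by move/eqP; rewrite eq_sym oner_eq0.
  by move=> i _; rewrite c0 normr0.
exists (`|lincomb b (c ord0)|^-1); first by rewrite invr_gt0.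
move=> a; rewrite mulrC ler_pdivlMr//; set s := \sum_i _.
have : 0 <= s by rewrite sumr_ge0.
rewrite le_eqVlt => /predU1P[<-|s0]; first by rewrite mul0r.
have : \row_i (s^-1 * a i) \in S.
  by rewrite inE; exact: scaleS.
move/cmin.
rewrite (_ : lincomb b ((\row_i (s^-1 * a i)) ord0) = s^-1 *: lincomb b a).
  by rewrite normrZ gtr0_norm ?invr_gt0// -ler_pdivlMl// invrK.
by rewrite -lincombZ; apply: eq_bigr => i _; rewrite mxE.
Qed.

End Independence.

Definition affine_span (R : realType) (X : normedModType R) n (x0 : X)
    (b : 'I_n -> X) : set X :=
  [set x0 + lincomb b a | a in [set: 'I_n -> R]].

Lemma affine_combE (R : realType) (X : normedModType R) n (x0 : X)
    (b : 'I_n -> X) a a' (t : R) :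
  t *: (x0 + lincomb b a) + (1 - t) *: (x0 + lincomb b a') =
  x0 + lincomb b (fun i => t * a i + (1 - t) * a' i).
Proof.
by rewrite lincombD !lincombZ !scalerDr addrACA -scalerDl addrC (addrC t) subrK
  scale1r addrC.
Qed.

Section AffineMaps.
Context {R : realType} {X Y : completeNormedModType R}.

(** Coordinates in an independent family are unique, so moving them from one
frame to the other is a well-defined affine bijection. *)
Lemma frame_map n (x0 : X) (b : 'I_n -> X) (y0 : Y) (b' : 'I_n -> Y) :
  lin_indep b -> lin_indep b' ->
  exists2 T : X -> Y,
    affine_iso (affine_span x0 b) (affine_span y0 b') T &
    forall a, T (x0 + lincomb b a) = y0 + lincomb b' a.
Proof.
move=> bi b'i.
have [c cP] : {c & forall x, affine_span x0 b x -> x = x0 + lincomb b (c x)}.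
  apply: (@choice _ _ (fun x c => affine_span x0 b x -> x = x0 + lincomb b c)).
  move=> x; have [[a _ <-]|nx] := pselect (affine_span x0 b x).
    by exists a.
  by exists (fun=> 0) => /nx.
pose T x := y0 + lincomb b' (c x).
have TE a : T (x0 + lincomb b a) = y0 + lincomb b' a.
  congr (_ + _); apply: eq_bigr => i _; congr (_ *: _).
  apply: (lincomb_inj bi); apply: (addrI x0); rewrite -cP//.
  by exists a.
exists T => //; split; first split.
- by move=> _ [a _ <-] /=; rewrite TE; exists a.
- move=> _ _ /set_mem[a _ <-] /set_mem[a' _ <-].
  rewrite !TE => /addrI/(lincomb_inj b'i) aa'.
  by congr (_ + _); apply: eq_bigr => i _; rewrite aa'.
- by move=> _ [a _ <-]; exists (x0 + lincomb b a) => //; exists a.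
by move=> _ _ t [a _ <-] [a' _ <-]; rewrite affine_combE !TE affine_combE.
Qed.

Lemma affine_set_aff (S : set X) : affine_set (aff S).
Proof.
move=> x y t Sx Sy L [affL SL].
by apply: (affL); [apply: Sx|apply: Sy].
Qed.

(** Being an extreme point is expressed by affine combinations only, and
injectivity of [T] reflects those of the image. *)
Lemma vert_affine_image (L : set X) (L' : set Y) (T : X -> Y) (H : set X) :
  affine_set L -> affine_iso L L' T -> H `<=` L ->
  vert (T @` H) = T @` vert H.
Proof.
move=> affL [[_ Tinj _] Taff] HL.
have inj x y : L x -> L y -> T x = T y -> x = y.
  by move=> Lx Ly; apply: Tinj; rewrite inE.
apply/seteqP; split.
  move=> _ [[x Hx <-] ext]; exists x => //; split=> // y z t Hy Hz t01 xE.
  have [||//||Ty Tz] := ext (T y) (T z) t.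
  - by exists y.
  - by exists z.
  - by rewrite xE Taff//; exact: HL.
  by split; apply: inj => //; exact: HL.
move=> _ [x [Hx ext] <-]; split; first by exists x.
move=> _ _ t [y Hy <-] [z Hz <-] t01.
have [Ly Lz] := (HL y Hy, HL z Hz); rewrite -Taff// => TxE.
have xE := inj _ _ (HL x Hx) (affL y z t Ly Lz) TxE.
by have [-> ->] := ext y z t Hy Hz t01 xE.
Qed.

Lemma hausdorff_dist_range_le (I : Type) (u v : I -> Y) (r : R) : 0 < r ->
  (forall i, `|u i - v i| <= r) ->
  (hausdorff_dist (range u) (range v) <= r%:E)%E.
Proof.
move=> r0 uv; apply: ereal_inf_lbound; exists r => //.
have half (u' v' : I -> Y) : (forall i, `|u' i - v' i| <= r) ->
    range u' `<=`
    [set d + r *: x | d in range v' & x in closed_ball (0 : Y) 1].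
  move=> u'v' _ [i _ <-]; exists (v' i); first by exists i.
  exists (r^-1 *: (u' i - v' i)).
    rewrite closed_ballE// /closed_ball_/= sub0r normrN normrZ.
    by rewrite gtr0_norm ?invr_gt0// mulrC ler_pdivrMr// mul1r.
  by rewrite scalerA divff ?gt_eqF// scale1r addrC subrK.
by split=> //; apply: half => // i; rewrite distrC.
Qed.

End AffineMaps.
(** * Frames of polyhedra *)

Section Frames.
Context {R : realType} {X : normedModType R} {n k : nat}.

(** A single family gathers the basis, the origin and the vertices, so that one
seminorm also measures the position of the vertices relative to the basis. *)
Definition frame : Type := 'I_n + 'I_1 + 'I_k -> X.
Implicit Type w : frame.

Definition basis w (i : 'I_n) : X := w (inl (inl i)).
Definition origin w : X := w (inl (inr ord0)).
Definition vertex w (j : 'I_k) : X := w (inr j).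

Definition frame_coef (a : 'I_n -> R) (t : R) (u : 'I_k -> R)
    (s : 'I_n + 'I_1 + 'I_k) : R :=
  match s with inl (inl i) => a i | inl (inr _) => t | inr j => u j end.

Lemma lincomb_frame w a t u : lincomb w (frame_coef a t u) =
  lincomb (basis w) a + t *: origin w + lincomb (vertex w) u.
Proof. by rewrite /lincomb !big_sumType/= big_ord1. Qed.

Lemma sum_norm_frame_coef a t u :
  \sum_s `|frame_coef a t u s| = \sum_i `|a i| + `|t| + \sum_j `|u j|.
Proof. by rewrite !big_sumType/= big_ord1. Qed.

Definition frame_of w (H : set X) : Prop :=
  [/\ lin_indep (basis w), aff H = affine_span (origin w) (basis w) &
      vert H = range (vertex w)].

End Frames.
Arguments frame {R} X n k.

Lemma polyhedron_frame (R : realType) (X : normedModType R) n m (H : set X) :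
  nm_polyhedron n m H -> exists w : frame X n (n + m + 1), frame_of w H.
Proof.
move=> [_ [x0 [b [bi affH]]] /card_esym/card_set_bijP[f [fH _ fsurj]]].
exists (fun s : 'I_n + 'I_1 + 'I_(n + m + 1) =>
  match s with inl (inl i) => b i | inl (inr _) => x0 | inr j => f j end).
split=> //.
apply/seteqP; split=> [v /fsurj[j /= jk <-]|_ [j _ <-]].
  by exists (Ordinal jk).
by apply: fH => /=.
Qed.

Section CloseFrames.
Context {R : realType} {X : completeNormedModType R} {n k : nat}.
Implicit Types (w : frame X n k) (H : set X).

(** The two uses of closeness: on vectors supported by the basis it compares
the norms of x - y and T x - T y, the hypothesis [d * C <= e] making the error
relative; on the vector of the relation [v_j = origin + sum_i c_i b_i], whose
combination vanishes in the first frame, it bounds the distance from T v_j to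
the j-th vertex of [H']. *)
Lemma close_frames_map w w' H H' (d C e r : R) :
  frame_of w H -> frame_of w' H' -> 0 < r -> 0 <= d ->
  (forall a, `| `|lincomb w a| - `|lincomb w' a| | <= d * \sum_s `|a s|) ->
  (forall a, \sum_i `|a i| <= C * `|lincomb (basis w) a|) -> d * C <= e ->
  (forall j, exists2 c, vertex w j = origin w + lincomb (basis w) c &
     d * (\sum_i `|c i| + 2) <= r) ->
  exists T : X -> X,
    [/\ affine_iso (aff H) (aff H') T,
        (forall x y : X, aff H x -> aff H y ->
           (1 - e) * `|x - y| <= `|T x - T y| <= (1 + e) * `|x - y|)
      & (hausdorff_dist (vert (T @` H)) (vert H') <= r%:E)%E].
Proof.
move=> [bi affH vertH] [b'i affH' vertH'] r0 d0 ww' wC dCe wr.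
have [T Tiso TE] := frame_map (origin w) (origin w') bi b'i.
exists T; split; first by rewrite affH affH'.
  move=> x y; rewrite affH => -[a _ <-] [a' _ <-].
  have shift (u p q : X) : (u + p) - (u + q) = p - q.
    by rewrite opprD addrACA subrr add0r.
  rewrite !TE !shift -!lincombB.
  set c := fun i => a i - a' i.
  have := ww' (frame_coef c 0 (fun=> 0)).
  have zero (u : frame X n k) : lincomb (vertex u) (fun=> 0) = 0.
    by apply: big1 => j _; rewrite scale0r.
  rewrite !lincomb_frame !zero !scale0r !addr0 sum_norm_frame_coef normr0.
  rewrite big1_eq !addr0 => close.
  have {close} : `| `|lincomb (basis w) c| - `|lincomb (basis w') c| | <=
      e * `|lincomb (basis w) c|.
    rewrite (le_trans close)//.
    rewrite (@le_trans _ _ (d * C * `|lincomb (basis w) c|))//.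
      by rewrite -mulrA ler_wpM2l.
    by rewrite ler_wpM2r.
  by rewrite ler_norml => /andP[? ?]; apply/andP; split; lra.
have subaff : H `<=` aff H by move=> x Hx L [_]; apply.
have -> : vert (T @` H) = range (T \o vertex w).
  rewrite (@vert_affine_image _ _ _ (aff H) (aff H'))//.
  - by rewrite vertH image_comp.
  - exact: affine_set_aff.
  - by rewrite affH affH'.
rewrite vertH'; apply: hausdorff_dist_range_le => // j /=.
have [c vE cr] := wr j; rewrite vE TE; apply: le_trans cr.
(* The vanishing combination; its l1 norm is sum_i |c i| + 2. *)
have := ww' (frame_coef c 1 (fun i => if i == j then -1 else 0)).
rewrite !lincomb_frame !lincomb_delta !scale1r !scaleN1r sum_norm_frame_coef.
rewrite -[X in d * (_ + X)](_ : 1 = _); last first.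
  rewrite (bigD1 j)//= eqxx normrN1 big1 ?addr0// => i /negPf ->.
  by rewrite normr0.
rewrite vE [lincomb (basis w) c + _]addrC subrr normr0 sub0r normrN normr_id.
by rewrite normr1 (addrC (lincomb _ _)) -(addrA _ 1 1).
Qed.

End CloseFrames.

(** The countable dense set of frames only matters through the vertices that it
uses, which lie in one countable set of points. *)
Lemma countable_vertices_dense (R : realType) (X : normedModType R) n k
    (P : set (frame X n k)) :
  exists B : set X,
    [/\ countable B, B `<=` \bigcup_(w in P) range (vertex w) &
      forall w (d : R), P w -> 0 < d -> exists w',
        [/\ P w', range (vertex w') `<=` B &
          forall a, `| `|lincomb w a| - `|lincomb w' a| | <=
            d * \sum_s `|a s|]].
Proof.
have [S [SP cS dense]] := countable_norm_dense P.
exists (\bigcup_(w in S) range (vertex w)); split.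
- apply: bigcup_countable => // w _.
  by apply: finite_set_countable; exact: finite_image.
- exact: bigcup_subset.
move=> w d Pw d0; have [w' Sw' ww'] := dense w d Pw d0.
by exists w'; split=> // [|x w'x]; [exact: SP|exists w'].
Qed.

Theorem theorem4p9 (R : realType) (X : completeNormedModType R) (A : set X) :
  exists A0 : set X,
    [/\ A0 `<=` A, countable A0 & strongly_finitely_representable A A0].
Proof.
pose P n m (w : frame X n (n + m + 1)) :=
  exists H, [/\ nm_polyhedron n m H, vert H `<=` A & frame_of w H].
have [B BP] := choice (fun nm : nat * nat =>
  countable_vertices_dense (@P nm.1 nm.2)).
exists (\bigcup_nm B nm); split.
- move=> x [nm _ Bx]; have [_ /(_ x Bx)[w [H [_ HA [_ _ vH]]] wx] _] := BP nm.
  by apply: HA; rewrite vH.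
- by apply: bigcup_countable => // nm _; have [] := BP nm.
move=> e e0 n m H Hnm HA.
have [w wH] := polyhedron_frame Hnm.
have [bi affH vertH] := wH.
have [C C0 wC] := sum_norm_le_lincomb bi.
have [c cP] : {c & forall j, vertex w j = origin w + lincomb (basis w) (c j)}.
  apply: (@choice _ _ (fun j c => vertex w j = origin w + lincomb (basis w) c)).
  move=> j; have : aff H (vertex w j).
    have [] : vert H (vertex w j) by rewrite vertH; exists j.
    by move=> Hv _ L [_]; apply.
  by rewrite affH => -[a _ <-]; exists a.
(* One constant for all vertices: M dominates the l1 norm of the relation of
   each of them. *)
pose M := \sum_j \sum_i `|c j i| + 2.
have M0 : 0 < M by rewrite ltr_wpDl// sumr_ge0// => j _; rewrite sumr_ge0.
pose d := Num.min (e / C) (e / 2 / M).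
have d0 : 0 < d by rewrite lt_min !divr_gt0.
have [_ _ dense] := BP (n, m).
have [|w' [[H' [H'nm _ w'H']] w'B ww']] := dense w d _ d0; first by exists H.
have [|||T [Tiso Tnorm Tdist]] :=
  @close_frames_map _ _ _ _ w w' H H' d C e (e / 2) wH w'H' _ (ltW d0) ww' wC.
- by rewrite divr_gt0.
- by rewrite -ler_pdivlMr// ge_min lexx.
- move=> j; exists (c j); first exact: cP.
  apply: (@le_trans _ _ (d * M)).
    rewrite ler_wpM2l ?(ltW d0)// lerD2r (bigD1 j)//= lerDl sumr_ge0// => i _.
    by rewrite sumr_ge0.
  by rewrite -ler_pdivlMr// ge_min lexx orbT.
exists H', T; split=> //.
- by have [_ _ ->] := w'H' => x /w'B Bx; exists (n, m).
- by apply: le_lt_trans Tdist _; rewrite lte_fin ltr_pdivrMr// ltr_pMr// ltr1n.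
Qed.
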